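(* Let $d\le n$ be positive integers, $\bm a_1,\dots,\bm a_n\in\mathbb{R}^d$, $\lambda>0$, and for $k\in[n]$ let $$z_k:=\min_{S\subseteq [n]}\left\{\operatorname{tr}\left(\left(\sum_{i\in S}\bm a_i\bm a_i^{\top}+\lambda \bm I_d\right)^{-1}\right): |S|=k\right\},$$ $$\nu_k^{\mathrm C}:=\min_{\bm x\in[0,1]^n}\left\{\operatorname{tr}\left(\left(\sum_{i\in[n]}x_i\bm a_i\bm a_i^{\top}+\lambda \bm I_d\right)^{-1}\right): \sum_{i\in[n]}x_i=k\right\}.$$ When $k=d$, $$1\le\frac{z_k}{\nu_k^{\mathrm C}}\le\min\{d,\,n-d+1\}.$$
   Context: $[n]=\{1,\dots,n\}$; the constraint $\bm x\in[0,1]^n$ uses the real unit interval; $\bm I_d$ is the $d\times d$ identity matrix. *)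

(* Defs.v *)
From HB Require Import structures.
From mathcomp Require Import all_boot all_order all_algebra.
From mathcomp Require Import all_classical all_reals all_analysis.

Set Implicit Arguments.
Unset Strict Implicit.
Unset Printing Implicit Defensive.

Import Order.TTheory GRing.Theory Num.Theory.

Local Open Scope classical_set_scope.
Local Open Scope ring_scope.

Definition is_minimum (R : realType) (A : set R) (m : R) : Prop :=
  A m /\ lbound A m.

(* The minimum of A when it is attained, and the junk value 0 otherwise.
   Since t / 0 = 0 and 0 / t = 0, a bound 1 <= set_min A / set_min B entails
   that both minima are attained. *)
Definition set_min (R : realType) (A : set R) : R :=
  xget 0 [set m | is_minimum A m].

Definition z_opt (R : realType) (n d : nat) (a : 'I_n -> 'cV[R]_d)
    (lambda : R) (k : nat) : R :=
  set_min [set v | exists2 S : {set 'I_n}, #|S| = k &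
    v = \tr (invmx (\sum_(i in S) a i *m (a i)^T + lambda%:M))].

Definition nuC_opt (R : realType) (n d : nat) (a : 'I_n -> 'cV[R]_d)
    (lambda : R) (k : nat) : R :=
  set_min [set v | exists2 x : 'rV[R]_n,
    (forall i, 0 <= x 0 i <= 1) /\ \sum_(i < n) x 0 i = k%:R &
    v = \tr (invmx (\sum_(i < n) x 0 i *: (a i *m (a i)^T) + lambda%:M))].

(* Main.v *)
(** Let [M] be the matrix [\sum_i x_i a_i a_i^T] for a feasible [x], and draw a
    set [S] of size [d] with probability proportional to
    [(\prod_(i in S) x_i) \det B_S], where [B_S] is the matrix
    [\sum_(i in S) a_i a_i^T].
    By Cauchy-Binet, [v^T adj(B_S) v] is the sum of the squared volumes of [v]
    together with [d - 1] vectors of [S]; summing over [S], each set [T] of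
    size [d - 1] gets the additional factor [\sum_(i notin T) x_i], which is at
    most [C = min (d, n - d + 1)].  Hence [E (B_S^-1) <= C M^-1] as quadratic
    forms.  This bound survives the regularization because
    [tr ((B + l)^-1)] is the minimum over [K] of
    [tr (K^T B^-1 K) + l^-1 tr ((1 - K)^T (1 - K))]: take the [K] that is
    optimal for [M] and use [1 <= C] for the second term.  So some [S] in the support
    of the law is good enough.  If [M] is singular, perturb the vectors. *)

Require Import Defs.
From HB Require Import structures.
From mathcomp Require Import all_boot all_order all_algebra.
From mathcomp Require Import all_classical all_reals all_analysis.
From mathcomp Require Import ring.

Set Implicit Arguments.
Unset Strict Implicit.
Unset Printing Implicit Defensive.

Import Order.TTheory GRing.Theory Num.Theory.
Import numFieldNormedType.Exports.

Local Open Scope ring_scope.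

(** * Cauchy-Binet and volume sampling *)

Lemma sum_indicator (R : pzRingType) (V : lmodType R) (I : finType)
    (S : {set I}) (F : I -> V) :
  \sum_i (i \in S)%:R *: F i = \sum_(i in S) F i.
Proof.
rewrite [RHS]big_mkcond; apply: eq_bigr => i _.
by case: (i \in S); rewrite ?scale1r ?scale0r.
Qed.

Section CauchyBinet.
Variables (R : comNzRingType) (I : finType) (d : nat).
Implicit Types (a : I -> 'cV[R]_d) (x : I -> R) (S : {set I}).

(** Coefficient of [\prod_r x (f r)] when the determinant is expanded by rows, row [r] taking the
    summand of index [f r]. *)
Let coef a (f : {ffun 'I_d -> I}) : R :=
  (\prod_r a (f r) r 0) * \det (\matrix_(r, c) a (f r) c 0).

Let det_gram_ffun a x :
  \det (\sum_i x i *: (a i *m (a i)^T)) =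
  \sum_(f : {ffun 'I_d -> I} | injectiveb f) (\prod_r x (f r)) * coef a f.
Proof.
have -> : \det (\sum_i x i *: (a i *m (a i)^T)) =
    \sum_(f : {ffun 'I_d -> I}) (\prod_r x (f r)) * coef a f.
  rewrite /determinant.
  under eq_bigr => s _.
    under eq_bigr => r _ do rewrite summxE.
    rewrite bigA_distr_bigA mulr_sumr /=; over.
  rewrite exchange_big; apply: eq_bigr => f _.
  rewrite /coef /determinant mulrA mulr_sumr; apply: eq_bigr => s _.
  rewrite mulrCA; congr (_ * _); rewrite -!big_split /=.
  by apply: eq_bigr => r _; rewrite !mxE big_ord1 !mxE mulrA.
rewrite (bigID (fun f : {ffun 'I_d -> I} => injectiveb f)) /=.
rewrite [X in _ + X]big1 ?addr0 // => f /injectivePn [r [s neq_rs fE]].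
rewrite /coef (determinant_alternate neq_rs) ?mulr0 // => c.
by rewrite !mxE fE.
Qed.

(** Only injective [f] survive, since a repeated index gives two equal rows. They are grouped by
    their image [S]; the same expansion with the indicator of [S] as weights evaluates each
    group. *)
Lemma cauchy_binet_gram a x :
  \det (\sum_i x i *: (a i *m (a i)^T)) =
  \sum_(S : {set I} | #|S| == d)
     (\prod_(i in S) x i) * \det (\sum_(i in S) a i *m (a i)^T).
Proof.
have card_im (f : {ffun 'I_d -> I}) : injectiveb f -> #|f @: [set: 'I_d]| = d.
  by move=> /injectiveP finj; rewrite card_imset ?cardsT ?card_ord.
rewrite det_gram_ffun.
rewrite (partition_big (fun f : {ffun 'I_d -> I} => f @: [set: 'I_d])
  (fun S => #|S| == d)) /=; last by move=> f /card_im ->.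
apply: eq_bigr => S /eqP cardS.
rewrite -sum_indicator det_gram_ffun mulr_sumr.
rewrite [RHS](bigID (fun f : {ffun 'I_d -> I} => f @: [set: 'I_d] == S)) /=.
rewrite [X in _ = _ + X]big1 ?addr0; last first.
  move=> f /andP[finj neqS].
  have /forallPn[r /negPf rS] : ~~ [forall r, f r \in S].
    apply: contra neqS => /forallP fS.
    rewrite eqEcard card_im // cardS leqnn andbT.
    by apply/fintype.subsetP => _ /imsetP[r _ ->].
  by rewrite (bigD1 r) //= rS !mul0r mulr0.
apply: eq_bigr => f /andP[finj /eqP fS].
rewrite -fS big_imset /=; last by move=> r s _ _; apply/injectiveP.
rewrite [X in _ = _ * (X * _)]big1 ?mul1r => [|r _]; last by rewrite imset_f.
by congr (_ * _); apply: eq_bigl => r; rewrite inE.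
Qed.

(** With the indicator of [A] as weights, the product over [S] is 1 if [S] lies in [A] and 0
    otherwise. *)
Lemma cauchy_binet_gram_set a (A : {set I}) :
  \det (\sum_(i in A) a i *m (a i)^T) =
  \sum_(S : {set I} | (#|S| == d) && (S \subset A))
     \det (\sum_(i in S) a i *m (a i)^T).
Proof.
rewrite -sum_indicator cauchy_binet_gram big_mkcondr; apply: eq_bigr => S _.
case: ifPn => [/fintype.subsetP SA|/fintype.subsetPn[i iS /negPf iA]].
  by rewrite big1 ?mul1r // => i /SA ->.
by rewrite (bigD1 i) //= iA !mul0r.
Qed.

(** The columns of [A] are the vectors of [S], so the determinant of this Gram matrix is a
    square. *)
Lemma gram_square a S : #|S| = d ->
  exists A : 'M[R]_d, \sum_(i in S) a i *m (a i)^T = A *m A^T.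
Proof.
move=> cardS.
exists (\matrix_(r, c) a (enum_val (cast_ord (esym cardS) c)) r 0).
apply/matrixP => r s; rewrite summxE !mxE big_enum_val /=.
rewrite (reindex (cast_ord (esym cardS))) /=; last first.
  exact/onW_bij/(Bijective (cast_ordK _) (cast_ordKV _)).
by apply: eq_bigr => c _; rewrite !mxE big_ord1 !mxE.
Qed.
End CauchyBinet.

(** Sylvester's identity: both block products equal the matrix with blocks [1], [-u], [v], [1], and
    every factor is block triangular. *)
Lemma det_1Dmulmx_swap (R : comNzRingType) (m n : nat)
    (u : 'M[R]_(m, n)) (v : 'M[R]_(n, m)) :
  \det (1%:M + u *m v) = \det (1%:M + v *m u).
Proof.
have e : block_mx 1%:M (- u) 0 1%:M *m block_mx (1%:M + u *m v) 0 v 1%:M =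
    block_mx 1%:M 0 v 1%:M *m block_mx 1%:M (- u) 0 (1%:M + v *m u).
  rewrite !mulmx_block; congr block_mx;
  by rewrite !(mul1mx, mulmx1, mul0mx, mulmx0, add0r, addr0, mulNmx, mulmxN)
    ?addrK // addrC ?addrK ?subrK.
have := congr1 determinant e.
by rewrite !det_mulmx !(det_ublock, det_lblock) !det1 !(mul1r, mulr1).
Qed.

(** Matrix determinant lemma. It trades quadratic forms in inverses for differences of determinants,
    to which Cauchy-Binet applies. *)
Lemma det_rank1_update (R : comUnitRingType) (d : nat)
    (B : 'M[R]_d) (v : 'cV[R]_d) : B \in unitmx ->
  \det (B + v *m v^T) - \det B = \det B * (v^T *m invmx B *m v) 0 0.
Proof.
move=> Bu.
have -> : B + v *m v^T = B *m (1%:M + (invmx B *m v) *m v^T).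
  by rewrite mulmxDr mulmx1 !mulmxA mulmxV // mul1mx.
rewrite det_mulmx det_1Dmulmx_swap det_mx11 mxE [1%:M 0 0]mxE eqxx.
by rewrite mulrDr mulr1 addrAC subrr add0r mulmxA.
Qed.

(** * Volume-sampling inequalities *)

Section VolumeSampling.
Variables (R : realFieldType) (d : nat).

Lemma det_gram_ge0 (I : finType) (a : I -> 'cV[R]_d) (S : {set I}) :
  #|S| = d -> 0 <= \det (\sum_(i in S) a i *m (a i)^T).
Proof.
move=> /(gram_square a)[A ->]; rewrite det_mulmx det_tr.
exact: sqr_ge0.
Qed.

Section Pointed.
Variables (J : finType) (o : J) (b : J -> 'cV[R]_d) (y : J -> R).
Hypothesis yo : y o = 1.
Local Notation B S := (\sum_(i in S) b i *m (b i)^T).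

(** These [S] arise from [U] by exchanging [o] for some [j] outside [U]; since [y o = 1], the weight
    of [S] is that of [U] times [y j]. *)
Let sum_superset_weight (U : {set J}) : #|U| = d -> o \in U ->
  \sum_(S : {set J} | [&& #|S| == d, o \notin S & U \subset o |: S])
     \prod_(j in S) y j = (\prod_(j in U) y j) * \sum_(j in ~: U) y j.
Proof.
move=> cardU oU; pose h j := j |: (U :\ o).
have cardUo : (#|U :\ o|).+1 = d by rewrite -cardU (cardsD1 o U) oU.
have hinj : {in ~: U &, injective h}.
  move=> i j; rewrite !inE => iU jU hE.
  have : i \in h j by rewrite -hE finset.setU11.
  by rewrite !inE (negPf iU) andbF orbF => /eqP.
rewrite (eq_bigl (mem (h @: ~: U))) => [|S]; last first.
  apply/idP/imsetP => [/and3P[/eqP cardS oS UoS]|[j]].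
    have UoS' : U :\ o \subset S.
      apply/fintype.subsetP => i; rewrite !inE => /andP[/negPf io iU].
      by have := fintype.subsetP UoS i iU; rewrite !inE io.
    have /eqP/cards1P[j Ej] : #|S :\: (U :\ o)| = 1%N.
      by rewrite cardsDS // cardS -cardUo subSnn.
    have : j \in S :\: (U :\ o) by rewrite Ej set11.
    rewrite !inE negb_and negbK => /andP[jUo jS].
    exists j; last first.
      rewrite -[LHS](finset.setID S (U :\ o)) (finset.setIidPr UoS') Ej.
      exact: finset.setUC.
    by rewrite !inE; case/orP: jUo => // /eqP jo; rewrite -jo jS in oS.
  rewrite !inE => jU ->.
  have oj : o != j by apply: contraNneq jU => <-.
  rewrite /h cardsU1 !inE (negPf jU) andbF /= add1n cardUo eqxx eqxx /=.
  rewrite (negPf oj) /=; apply/fintype.subsetP => i iU; rewrite !inE iU andbT.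
  by case: eqP; rewrite ?orbT.
rewrite (big_imset _ hinj) /= mulr_sumr; apply: eq_bigr => j.
rewrite inE => jU; rewrite /h big_setU1 /=; last first.
  by rewrite !inE (negPf jU) andbF.
by rewrite (big_setD1 o oU) /= yo mul1r mulrC.
Qed.

(** Both differences retain only the [d]-sets [U] containing [o]. After the sums are exchanged, each
    [U] carries as extra factor the total weight of its complement, at most [C]. *)
Lemma volume_sampling_pointed (C : R) : (forall j, 0 <= y j) ->
  (forall U : {set J}, #|U| = d -> o \in U -> \sum_(j in ~: U) y j <= C) ->
  \sum_(S : {set J} | (#|S| == d) && (o \notin S))
     (\prod_(j in S) y j) * (\det (B (o |: S)) - \det (B S)) <=
  C * (\det (\sum_j y j *: (b j *m (b j)^T))
       - \det (\sum_(j | j != o) y j *: (b j *m (b j)^T))).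
Proof.
move=> y0 yC.
have -> : \det (\sum_j y j *: (b j *m (b j)^T))
       - \det (\sum_(j | j != o) y j *: (b j *m (b j)^T)) =
    \sum_(U : {set J} | (#|U| == d) && (o \in U))
       (\prod_(j in U) y j) * \det (B U).
  (* Giving [o] weight 0 puts both determinants on the same index set, so that Cauchy-Binet compares
     them set by set. *)
  have -> : \sum_(j | j != o) y j *: (b j *m (b j)^T) =
      \sum_j (if j != o then y j else 0) *: (b j *m (b j)^T).
    rewrite big_mkcond; apply: eq_bigr => j _.
    by case: (j != o); rewrite ?scale0r.
  rewrite !cauchy_binet_gram -sumrB [RHS]big_mkcondr; apply: eq_bigr => U _.
  case: ifPn => oU.
    by rewrite [X in _ - X * _](bigD1 o) //= eqxx !mul0r subr0.
  rewrite [X in _ - X * _](eq_bigr y) ?subrr // => j jU.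
  by rewrite ifT //; apply: contraNneq oU => <-.
rewrite (_ : \sum_(S : {set J} | _) _ =
    \sum_(S : {set J} | (#|S| == d) && (o \notin S))
    \sum_(U : {set J} | [&& #|U| == d, o \in U & U \subset o |: S])
       (\prod_(j in S) y j) * \det (B U)); last first.
  apply: eq_bigr => S /andP[/eqP cardS oS]; rewrite -mulr_sumr; congr (_ * _).
  (* Subtracting the term [U = S] leaves the [d]-subsets of [o |: S] that contain [o]. *)
  rewrite cauchy_binet_gram_set (bigD1 S) ?cardS ?eqxx ?finset.subsetUr //=.
  rewrite addrAC subrr add0r; apply: eq_bigl => U.
  rewrite -andbA; case: eqP => //= cardU.
  rewrite [RHS]andbC; case: (boolP (U \subset _)) => //= UoS.
  apply/idP/idP => [US|oU]; last by apply: contraNneq oS => <-.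
  apply: contraNT US => oU; rewrite eqEcard cardU cardS leqnn andbT.
  apply/fintype.subsetP => j jU; have := fintype.subsetP UoS j jU.
  rewrite !inE => /orP[|//].
  by move=> /eqP jo; rewrite -jo jU in oU.
rewrite (exchange_big_dep (fun U : {set J} => (#|U| == d) && (o \in U))) /=;
  last by move=> S U _ /and3P[-> ->].
rewrite mulr_sumr; apply: ler_sum => U /andP[/eqP cardU oU].
rewrite -mulr_suml.
rewrite (eq_bigl (fun S : {set J} =>
   [&& #|S| == d, o \notin S & U \subset o |: S])); last first.
  by move=> S; rewrite cardU oU eqxx /= andbA.
rewrite sum_superset_weight // mulrAC mulrC.
apply: ler_wpM2r; last exact: yC.
by apply: mulr_ge0; [apply: prodr_ge0 | apply: det_gram_ge0].
Qed.
End Pointed.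
End VolumeSampling.

(** Cauchy-Binet over the columns of [A], with unit weights. *)
Lemma det_mulmx_tr_ge0 (R : realFieldType) (d m : nat) (A : 'M[R]_(d, m)) :
  0 <= \det (A *m A^T).
Proof.
have -> : A *m A^T = \sum_j 1 *: (col j A *m (col j A)^T).
  apply/matrixP => r s; rewrite summxE !mxE; apply: eq_bigr => j _.
  by rewrite scale1r !mxE big_ord1 !mxE.
rewrite cauchy_binet_gram; apply: sumr_ge0 => S /eqP cardS.
by rewrite big1 // mul1r det_gram_ge0.
Qed.

Section Averaging.
Variables (R : realFieldType) (d : nat) (I : finType).
Variables (a : I -> 'cV[R]_d) (x : I -> R) (C : R).
Hypothesis x_ge0 : forall i, 0 <= x i.
Hypothesis sum_outside :
  forall T : {set I}, #|T|.+1 = d -> \sum_(i in ~: T) x i <= C.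
Local Notation B S := (\sum_(i in S) a i *m (a i)^T).
Local Notation M := (\sum_i x i *: (a i *m (a i)^T)).

Lemma volume_sampling_update (v : 'cV[R]_d) :
  \sum_(S : {set I} | #|S| == d)
     (\prod_(i in S) x i) * (\det (B S + v *m v^T) - \det (B S)) <=
  C * (\det (M + v *m v^T) - \det M).
Proof.
(* The vector [v] joins the family at index [None]. *)
pose b j := oapp a v j; pose y j := oapp x 1 j.
have noneSome (S : {set I}) : None \notin Some @: S.
  by apply/imsetP => -[].
have sumSome (V : nmodType) (F : option I -> V) :
    \sum_(j | j != None) F j = \sum_i F (Some i).
  rewrite (reindex_omap Some id) /=; last by case.
  by apply: eq_bigl => i; rewrite eqxx.
have := @volume_sampling_pointed R d _ None b y erefl C.
rewrite (bigD1 None) //= !sumSome /= scale1r [X in \det X]addrC.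
rewrite (reindex_onto (fun S : {set I} => Some @: S)
                      (fun S => Some @^-1: S)) /=; last first.
  move=> S /andP[_ nS]; apply/setP => -[i|].
    by rewrite mem_imset ?inE // => ? ? [].
  by rewrite (negPf (noneSome _)) (negPf nS).
have SomeI : injective (@Some I) by move=> ? ? [].
rewrite (eq_bigl (fun S : {set I} => #|S| == d)) => [|S]; last first.
  rewrite card_imset // noneSome andbT andb_idr // => _.
  by apply/eqP/setP => i; rewrite inE mem_imset.
rewrite (eq_bigr (fun S : {set I} => (\prod_(i in S) x i) *
    (\det (B S + v *m v^T) - \det (B S)))) => [|S _]; last first.
  rewrite big_setU1 ?noneSome //= !(big_imset _ (in2W SomeI)) /=.
  by rewrite [v *m _ + _]addrC.
apply; first by case=> [i|] /=.
(* Removing [None] from [U] leaves a set [T] of [d - 1] indices with the same complement, hence the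
   size in [sum_outside]. *)
move=> U cardU nU; pose T := Some @^-1: U.
have ET : ~: U = Some @: ~: T.
  apply/setP => -[i|]; first by rewrite mem_imset ?inE.
  by rewrite (negPf (noneSome _)) inE nU.
rewrite ET (big_imset _ (in2W SomeI)) /=; apply: sum_outside.
have -> : T = Some @^-1: (U :\ None) by apply/setP => i; rewrite !inE.
rewrite -(card_imset _ SomeI) -cardU (cardsD1 None U) nU add1n.
congr _.+1; congr #|pred_of_set _|; apply/setP => -[i|].
  by rewrite mem_imset ?inE.
by rewrite (negPf (noneSome _)) !inE.
Qed.

Lemma volume_sampling_trace (m : nat) (X : 'M[R]_(d, m)) : M \in unitmx ->
  \sum_(S : {set I} | (#|S| == d) && (B S \in unitmx))
     (\prod_(i in S) x i) * \det (B S) * \tr (X^T *m invmx (B S) *m X) <=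
  C * \det M * \tr (X^T *m invmx M *m X).
Proof.
move=> Mu.
have trE (P : 'M[R]_d) :
    \tr (X^T *m P *m X) = \sum_j ((col j X)^T *m P *m col j X) 0 0.
  apply: eq_bigr => j _.
  by rewrite tr_col -row_mul -[row j _ *m _]row_mul colE mulmxA -colE !mxE.
rewrite !trE mulr_sumr.
under eq_bigr do rewrite trE mulr_sumr.
rewrite exchange_big /=; apply: ler_sum => j _.
rewrite -mulrA -det_rank1_update //.
apply: le_trans (volume_sampling_update (col j X)).
rewrite [leRHS](bigID (fun S : {set I} => B S \in unitmx)) /= -[leLHS]addr0.
apply: lerD.
  by apply: ler_sum => S /andP[_ Bu]; rewrite -mulrA -det_rank1_update.
apply: sumr_ge0 => S /andP[/eqP cardS].
rewrite unitmxE unitfE negbK => /eqP ->; rewrite subr0.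
apply: mulr_ge0; first exact: prodr_ge0.
have [A ->] := gram_square a cardS.
(* Appending the vector to [A] as a further column makes the updated matrix a Gram matrix again. *)
by rewrite -mul_row_col -tr_row_mx det_mulmx_tr_ge0.
Qed.
End Averaging.

(** * Regularized inverses of positive semidefinite matrices *)

Section PositiveSemidefinite.
Variables (R : realFieldType) (d : nat).

Lemma trace_mulmx_tr_ge0 (p m : nat) (A : 'M[R]_(p, m)) :
  0 <= \tr (A^T *m A).
Proof.
by apply: sumr_ge0 => j _; rewrite mxE sumr_ge0 // => i _; rewrite mxE sqr_ge0.
Qed.

Lemma trace_mulmx_tr_eq0 (p m : nat) (A : 'M[R]_(p, m)) :
  \tr (A^T *m A) = 0 -> A = 0.
Proof.
move=> A0; apply/matrixP => i j; rewrite mxE; apply/eqP.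
have sq k l : 0 <= A^T k l * A l k by rewrite mxE sqr_ge0.
move/eqP: A0; rewrite psumr_eq0; last by move=> k _; rewrite mxE sumr_ge0.
move=> /allP/(_ j (mem_index_enum _)); rewrite mxE /= psumr_eq0 //.
by move=> /allP/(_ i (mem_index_enum _)); rewrite mxE mulf_eq0 orbb.
Qed.

(** Semidefiniteness is tested on matrices [X] of every width because traces are what is used later;
    width 1 is the usual quadratic form. *)
Definition psd (M : 'M[R]_d) : Prop :=
  M^T = M /\ forall m (X : 'M[R]_(d, m)), 0 <= \tr (X^T *m M *m X).

Lemma psd_gram (I : finType) (a : I -> 'cV[R]_d) (x : I -> R) :
  (forall i, 0 <= x i) -> psd (\sum_i x i *: (a i *m (a i)^T)).
Proof.
move=> x0; split=> [|m X].
  rewrite linear_sum; apply: eq_bigr => i _.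
  by rewrite linearZ /= trmx_mul trmxK.
rewrite mulmx_sumr mulmx_suml linear_sum; apply: sumr_ge0 => i _ /=.
rewrite -scalemxAr -scalemxAl linearZ mulr_ge0 //=.
have := trace_mulmx_tr_ge0 ((a i)^T *m X).
by rewrite trmx_mul trmxK !mulmxA.
Qed.

Lemma psd_gram_set (I : finType) (a : I -> 'cV[R]_d) (S : {set I}) :
  psd (\sum_(i in S) a i *m (a i)^T).
Proof. by rewrite -sum_indicator; apply: psd_gram => i; rewrite ler0n. Qed.

Lemma psd_invmx (B : 'M[R]_d) : psd B -> psd (invmx B).
Proof.
(* [invmx] returns its argument on a singular matrix, so that case is immediate. *)
move=> Bp; case: (boolP (B \in unitmx)) => [Bu|/invmx_out -> //].
have [BT B0] := Bp; split=> [|m X]; first by rewrite trmx_inv BT.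
have := B0 _ (invmx B *m X).
by rewrite trmx_mul trmx_inv BT -!mulmxA mulKVmx // !mulmxA.
Qed.

Variables (l : R) (l_gt0 : 0 < l).

Lemma psdD_trace (B : 'M[R]_d) (m : nat) (X : 'M[R]_(d, m)) : psd B ->
  l * \tr (X^T *m X) <= \tr (X^T *m (B + l%:M) *m X).
Proof.
move=> [_ B0]; rewrite mulmxDr mulmxDl linearD /= mul_mx_scalar -scalemxAl.
by rewrite linearZ /= lerDr.
Qed.

Lemma psdD_unitmx (B : 'M[R]_d) : psd B -> B + l%:M \in unitmx.
Proof.
move=> Bp; rewrite -row_free_unit; apply: inj_row_free => u u0.
have := psdD_trace u^T Bp.
rewrite trmxK u0 mul0mx linear0 pmulr_rle0 // => u_le0.
apply: trmx_inj; rewrite trmx0; apply: trace_mulmx_tr_eq0.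
by apply/eqP; have := trace_mulmx_tr_ge0 u^T; rewrite trmxK eq_le u_le0.
Qed.

Lemma psdD_trace_invmx_gt0 (B : 'M[R]_d) : (0 < d)%N -> psd B ->
  0 < \tr (invmx (B + l%:M)).
Proof.
move=> d_gt0 Bp; have Bu := psdD_unitmx Bp; set G := invmx _.
have GT : G^T = G by rewrite trmx_inv linearD /= (proj1 Bp) tr_scalar_mx.
(* The test matrix is [G] itself: [G^T (B + l) G] reduces to [G], which is nonzero because
   [d > 0]. *)
have := psdD_trace G Bp; rewrite GT mulVmx // mul1mx; apply: lt_le_trans.
have := trace_mulmx_tr_ge0 G; rewrite le_eqVlt => /predU1P[|]; last first.
  by rewrite GT; apply: mulr_gt0.
move=> /esym/trace_mulmx_tr_eq0 G0.
have := mulmxV Bu; rewrite -/G G0 mulmx0.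
move=> /matrixP/(_ (Ordinal d_gt0) (Ordinal d_gt0)).
by rewrite !mxE eqxx => /eqP; rewrite eq_sym oner_eq0.
Qed.

(** Completing the square around the minimizer [G *m B]: the terms linear in the deviation [X]
    cancel. Taking [X = 0] gives the minimum, and the quadratic terms have nonnegative trace. *)
Lemma invmxD_square_completion (B X : 'M[R]_d) : psd B -> B \in unitmx ->
  let G := invmx (B + l%:M) in let K := G *m B + X in
  K^T *m invmx B *m K + l^-1 *: ((1%:M - K)^T *m (1%:M - K)) =
  G + X^T *m invmx B *m X + l^-1 *: (X^T *m X).
Proof.
move=> Bp Bu G K; have Ru := psdD_unitmx Bp.
have l0 : l != 0 by rewrite gt_eqF.
have GT : G^T = G by rewrite trmx_inv linearD /= (proj1 Bp) tr_scalar_mx.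
have BG : B *m G = 1%:M - l *: G.
  by rewrite -(mulmxV Ru) mulmxDl mul_scalar_mx addrK.
have GB : G *m B = 1%:M - l *: G.
  by rewrite -(mulVmx Ru) mulmxDr mul_mx_scalar addrK.
have PK : invmx B *m (1%:M - l *: G) = G by rewrite -BG mulKmx.
have KP : (1%:M - l *: G) *m invmx B = G by rewrite -GB mulmxK.
have -> : 1%:M - K = l *: G - X.
  by rewrite /K GB opprD opprB addrA addrCA subrr addr0.
rewrite /K GB.
have -> : (1%:M - l *: G + X)^T = 1%:M - l *: G + X^T.
  by rewrite !linearD linearN linearZ /= trmx1 GT.
have -> : (l *: G - X)^T = l *: G - X^T by rewrite linearB linearZ /= GT.
rewrite [(1%:M - l *: G + X^T) *m _]mulmxDl KP mulmxDl mulmxDr mulmxDr.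
rewrite -[X^T *m invmx B *m (_ - _)]mulmxA PK mulmxBr mulmx1 -scalemxAr.
rewrite mulmxBl !mulmxBr -!scalemxAl -!scalemxAr.
(* With the matrix products made opaque, the identity is entrywise and commutative. *)
move: (G *m G) (G *m X) (X^T *m G) (X^T *m X) (X^T *m _ *m X) => U V W Y Z.
apply/matrixP => i j; rewrite !mxE; field.
by rewrite l0.
Qed.

Lemma invmxD_trace_le (B K : 'M[R]_d) : psd B -> B \in unitmx ->
  \tr (invmx (B + l%:M)) <=
  \tr (K^T *m invmx B *m K) + l^-1 * \tr ((1%:M - K)^T *m (1%:M - K)).
Proof.
move=> Bp Bu.
have := invmxD_square_completion (K - invmx (B + l%:M) *m B) Bp Bu.
rewrite /= subrKC => /(congr1 mxtrace).
rewrite !mxtraceD !mxtraceZ => ->; rewrite -addrA lerDl addr_ge0 //.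
  exact: (proj2 (psd_invmx Bp)).
by rewrite mulr_ge0 ?trace_mulmx_tr_ge0 // invr_ge0 ltW.
Qed.

Lemma invmxD_trace_eq (B : 'M[R]_d) : psd B -> B \in unitmx ->
  let K := invmx (B + l%:M) *m B in
  \tr (K^T *m invmx B *m K) + l^-1 * \tr ((1%:M - K)^T *m (1%:M - K)) =
  \tr (invmx (B + l%:M)).
Proof.
move=> Bp Bu; have := invmxD_square_completion 0 Bp Bu.
rewrite /= !addr0 => /(congr1 mxtrace); rewrite !mxtraceD !mxtraceZ => ->.
by rewrite !mulmx0 linear0 mulr0 !addr0.
Qed.

End PositiveSemidefinite.

(** * Averaging over sets in the invertible case *)

Lemma exists_subset_trace_invmx_le_unitmx (R : realFieldType) (d : nat) (I : finType)
    (a : I -> 'cV[R]_d) (x : I -> R) (C l : R) :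
  1 <= C -> 0 < l -> (forall i, 0 <= x i) ->
  (forall T : {set I}, #|T|.+1 = d -> \sum_(i in ~: T) x i <= C) ->
  \sum_i x i *: (a i *m (a i)^T) \in unitmx ->
  exists2 S : {set I}, #|S| = d &
    \tr (invmx (\sum_(i in S) a i *m (a i)^T + l%:M)) <=
    C * \tr (invmx (\sum_i x i *: (a i *m (a i)^T) + l%:M)).
Proof.
move=> C1 l0 x0 xC Mu.
set M := \sum_i _ in Mu *; pose B (S : {set I}) := \sum_(i in S) a i *m (a i)^T.
have Mp : psd M by apply: psd_gram.
pose good (S : {set I}) := (#|S| == d) && (B S \in unitmx).
pose w (S : {set I}) := (\prod_(i in S) x i) * \det (B S).
(* The weights [w] form the unnormalized law, of total mass [\det M]; singular sets have weight
   0. *)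
have detM : \det M = \sum_(S | good S) w S.
  rewrite /M cauchy_binet_gram (bigID (fun S => B S \in unitmx)) /=.
  rewrite [X in _ + X]big1 ?addr0 // => S /andP[_].
  by rewrite unitmxE unitfE negbK => /eqP ->; rewrite mulr0.
have w0 S : good S -> 0 <= w S.
  by move=> /andP[/eqP cardS _]; rewrite mulr_ge0 ?prodr_ge0 ?det_gram_ge0.
have detM0 : 0 <= \det M by rewrite detM sumr_ge0.
set f := \tr (invmx (M + _)); pose g S := \tr (invmx (B S + l%:M)).
have key : \sum_(S | good S) w S * g S <= \sum_(S | good S) w S * (C * f).
  rewrite -mulr_suml -detM /f -(invmxD_trace_eq l0 Mp Mu) /=.
  (* The matrix [K] optimal for [M] serves as trial matrix for every [S]. *)
  set K := _ *m M; set q := l^-1 * _.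
  have q0 : 0 <= q by rewrite mulr_ge0 ?trace_mulmx_tr_ge0 // invr_ge0 ltW.
  apply: (@le_trans _ _ (\sum_(S | good S)
      (w S * \tr (K^T *m invmx (B S) *m K) + w S * q))).
    apply: ler_sum => S gS; rewrite -mulrDr ler_wpM2l ?w0 //.
    by apply: invmxD_trace_le => //; [apply: psd_gram_set | case/andP: gS].
  rewrite big_split /= -mulr_suml -detM !mulrDr.
  apply: lerD; last by rewrite ler_wpM2l // ler_peMl.
  by rewrite mulrA [_ * C]mulrC; apply: volume_sampling_trace.
have [/exists_inP[S gS gle]|/exists_inPn gt] :=
    boolP [exists S in good, g S <= C * f].
  by exists S => //; case/andP: gS => /eqP.
(* If every good [S] exceeded [C * f], the averaged bound would force all weights to be 0, and with
   them [\det M]. *)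
have /eqP : \det M = 0; last first.
  by move: Mu; rewrite unitmxE unitfE => /negPf ->.
have ge S : good S -> 0 <= w S * (g S - C * f).
  by move=> gS; rewrite mulr_ge0 ?w0 // subr_ge0 ltW // ltNge gt.
have /eqP : \sum_(S | good S) w S * (g S - C * f) = 0.
  apply/eqP; rewrite eq_le sumr_ge0 // andbT.
  by under eq_bigr do rewrite mulrBr; rewrite sumrB subr_le0.
rewrite psumr_eq0 // => /allP z; rewrite detM big1 // => S gS.
have := z S (mem_index_enum _); rewrite gS /= mulf_eq0 => /orP[/eqP //|].
by rewrite subr_eq0 => /eqP gE; have := gt S gS; rewrite gE lexx.
Qed.

(** * Singular matrices and the attainment of the minima *)

Section MatrixLimits.
Local Open Scope classical_set_scope.
Variables (R : realType) (T : Type) (F : set_system T).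
Context {FF : Filter F}.

Lemma cvg_det (d : nat) (A : T -> 'M[R]_d) (B : 'M[R]_d) :
  (forall i j, A t i j @[t --> F] --> B i j) ->
  \det (A t) @[t --> F] --> \det B.
Proof.
move=> AB; apply: cvg_big; first exact: add_continuous.
move=> s _; apply: cvgM; first exact: cvg_cst.
by apply: cvg_big => //; exact: mul_continuous.
Qed.

Lemma cvg_trace_invmx (d : nat) (A : T -> 'M[R]_d) (B : 'M[R]_d) :
  (forall i j, A t i j @[t --> F] --> B i j) ->
  (forall t, A t \in unitmx) -> B \in unitmx ->
  \tr (invmx (A t)) @[t --> F] --> \tr (invmx B).
Proof.
move=> AB Au Bu; apply: cvg_big; first exact: add_continuous.
move=> i _; rewrite /invmx Bu mxE.
under eq_cvg do rewrite Au mxE.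
apply: cvgM.
  by apply: cvgV; [rewrite -unitfE -unitmxE | exact: cvg_det].
rewrite mxE; under eq_cvg do rewrite mxE.
apply: cvgM; first exact: cvg_cst.
apply: cvg_det => k l; rewrite !mxE; under eq_cvg do rewrite !mxE.
exact: AB.
Qed.

(** Both vectors and weights may vary: the perturbation moves the vectors, the attainment proof
    moves the weights. *)
Lemma cvg_gramD_trace_invmx (d : nat) (I : finType) (l : R)
    (a : T -> I -> 'cV[R]_d) (b : I -> 'cV[R]_d)
    (x : T -> I -> R) (y : I -> R) : 0 < l ->
  (forall t i, 0 <= x t i) -> (forall i, 0 <= y i) ->
  (forall i r, a t i r 0 @[t --> F] --> b i r 0) ->
  (forall i, x t i @[t --> F] --> y i) ->
  \tr (invmx (\sum_i x t i *: (a t i *m (a t i)^T) + l%:M)) @[t --> F] -->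
  \tr (invmx (\sum_i y i *: (b i *m (b i)^T) + l%:M)).
Proof.
move=> l0 x0 y0 ab xy; apply: cvg_trace_invmx => [r s|t|]; last 2 first.
- exact/psdD_unitmx/psd_gram.
- exact/psdD_unitmx/psd_gram.
rewrite mxE; under eq_cvg do rewrite mxE.
apply: cvgD; last exact: cvg_cst.
rewrite summxE; under eq_cvg do rewrite summxE.
apply: cvg_big => [|i _]; first exact: add_continuous.
rewrite !(mxE, big_ord1); under eq_cvg do rewrite !(mxE, big_ord1).
by apply: cvgM => //; apply: cvgM.
Qed.
End MatrixLimits.

(** As a polynomial in [t], the determinant is the characteristic polynomial of [- A], of degree
    [d]; it cannot vanish at [d + 1] distinct points. *)
Lemma small_shift_unitmx (R : realFieldType) (d : nat) (A : 'M[R]_d) (e : R) :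
  0 < e -> exists2 t, 0 < t < e & A + t%:M \in unitmx.
Proof.
(* The denominator [k.+2] keeps even the first point strictly below [e]. *)
move=> e0; pose u (k : nat) := e / k.+2%:R.
have ub k : 0 < u k < e.
  by rewrite divr_gt0 //= ltr_pdivrMr // ltr_pMr // ltr1n.
have [/hasP[_ /mapP[k _ ->] uk]|/hasPn nu] :=
    boolP (has (fun t => A + t%:M \in unitmx) (map u (iota 0 d.+1))).
  by exists (u k).
suff: (size (map u (iota 0 d.+1)) < size (char_poly (- A)))%N.
  by rewrite size_char_poly size_map size_iota ltnn.
apply: max_poly_roots.
- by rewrite -size_poly_gt0 size_char_poly.
- apply/allP => t /nu; rewrite unitmxE unitfE negbK => /eqP det0.
  apply/eqP; rewrite -det0 /char_poly -[LHS]/(horner_eval t _) -det_map_mx.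
  congr (\det _); apply/matrixP => i j; rewrite !mxE /= /horner_eval.
  by rewrite !hornerE hornerMn hornerX opprK addrC.
- rewrite map_inj_uniq ?iota_uniq // => k m /(mulfI (lt0r_neq0 e0)).
  by move=> /invr_inj /eqP; rewrite eqr_nat => /eqP[].
Qed.

Lemma exists_subset_trace_invmx_le (R : realType) (d : nat) (I : finType)
    (a : I -> 'cV[R]_d) (x : I -> R) (C l : R) :
  1 <= C -> 0 < l -> (forall i, 0 <= x i <= 1) -> d%:R <= \sum_i x i ->
  (forall T : {set I}, #|T|.+1 = d -> \sum_(i in ~: T) x i <= C) ->
  exists2 S : {set I}, #|S| = d &
    \tr (invmx (\sum_(i in S) a i *m (a i)^T + l%:M)) <=
    C * \tr (invmx (\sum_i x i *: (a i *m (a i)^T) + l%:M)).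
Proof.
move=> C1 l0 x01 xd xC.
have x0 i : 0 <= x i by case/andP: (x01 i).
pose supp := [set i | x i != 0].
(* Weights at most 1 with sum at least [d] force at least [d] nonzero weights. *)
have dsupp : (d <= #|supp|)%N.
  rewrite -(ler_nat R) (le_trans xd) // -sum1_card natr_sum.
  rewrite [leRHS]big_mkcond; apply: ler_sum => i _; rewrite inE.
  by case: eqP => [->|_] //; case/andP: (x01 i).
pose e (c : 'I_d) := enum_val (widen_ord dsupp c).
have einj : injective e by move=> r s /enum_val_inj /(congr1 val) /= /val_inj.
pose p i : 'cV[R]_d := \col_r (e r == i)%:R.
(* The perturbed vectors: those with index [e c] form the matrix [A0 + t%:M]. *)
pose at_ t i := a i + t *: p i.
pose A0 := \matrix_(r, c) a (e c) r 0.
(* The Cauchy-Binet term of the image of [e] is a product of positive weights times the squared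
   determinant of [A0 + t%:M]; the other terms are nonnegative. *)
have Mt t : A0 + t%:M \in unitmx ->
    \sum_i x i *: (at_ t i *m (at_ t i)^T) \in unitmx.
  move=> Atu; rewrite unitmxE unitfE gt_eqF // cauchy_binet_gram.
  have cardT : #|e @: [set: 'I_d]| = d by rewrite card_imset ?cardsT ?card_ord.
  rewrite (bigD1 (e @: [set: 'I_d])) ?cardT //=; apply: ltr_pwDl; last first.
    apply: sumr_ge0 => S /andP[/eqP cardS _].
    by rewrite mulr_ge0 ?prodr_ge0 ?det_gram_ge0.
  apply: mulr_gt0.
    apply: prodr_gt0 => _ /imsetP[c _ ->]; rewrite lt_neqAle x0 eq_sym andbT.
    by have := enum_valP (widen_ord dsupp c); rewrite inE.
  have -> : \sum_(i in e @: [set: 'I_d]) at_ t i *m (at_ t i)^T =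
      (A0 + t%:M) *m (A0 + t%:M)^T.
    rewrite big_imset /=; last by move=> r s _ _; apply: einj.
    apply/matrixP => r s; rewrite summxE mxE.
    apply: eq_big => c; first by rewrite inE.
    by rewrite !(mxE, big_ord1) !(inj_eq einj) !mulr_natr.
  rewrite det_mulmx det_tr -expr2 lt_neqAle sqr_ge0 andbT eq_sym sqrf_eq0.
  by rewrite -unitfE -unitmxE.
pose fx t := \tr (invmx (\sum_i x i *: (at_ t i *m (at_ t i)^T) + l%:M)).
pose fS (S : {set I}) t :=
  \tr (invmx (\sum_i (i \in S)%:R *: (at_ t i *m (at_ t i)^T) + l%:M)).
have fSE S t : fS S t =
    \tr (invmx (\sum_(i in S) at_ t i *m (at_ t i)^T + l%:M)).
  by rewrite /fS sum_indicator.
have at0 : at_ 0 = a by apply/funext => i; rewrite /at_ scale0r addr0.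
have cvg_at i r : (at_ t i r 0 @[t --> nbhs (0 : R)] --> at_ 0 i r 0)%classic.
  rewrite !mxE; under eq_cvg do rewrite !mxE.
  apply: cvgD; first exact: cvg_cst.
  by apply: cvgM; [exact: cvg_id | exact: cvg_cst].
have cvg_fx : (fx t @[t --> nbhs (0 : R)] --> fx 0)%classic.
  by apply: cvg_gramD_trace_invmx => // i; exact: cvg_cst.
have cvg_fS S : (fS S t @[t --> nbhs (0 : R)] --> fS S 0)%classic.
  by apply: cvg_gramD_trace_invmx => // i; exact: cvg_cst.
have [/existsP[S /andP[/eqP cardS fle]]|/existsPn fgt] :=
    boolP [exists S : {set I}, (#|S| == d) && (fS S 0 <= C * fx 0)].
  by exists S => //; move: fle; rewrite fSE /fx at0.
(* If every [S] fails at [t = 0], the finitely many strict inequalities persist on one neighbourhood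
   of 0, against the invertible case at a small shift [t]. *)
have : (\forall t \near (0 : R), forall S : {set I},
    #|S| = d -> 0 < fS S t - C * fx t)%classic.
  refine (@filter_forall R {set I}
    (fun (S : {set I}) t => #|S| = d -> 0 < fS S t - C * fx t)
    (nbhs (0 : R)) _ _) => S.
  case: (eqVneq #|S| d) => cardS; last first.
    by near=> t => dS; rewrite dS eqxx in cardS.
  have lim : (fS S t - C * fx t @[t --> nbhs (0 : R)] -->
      fS S 0 - C * fx 0)%classic.
    by apply: cvgB => //; apply: cvgM => //; exact: cvg_cst.
  have S0 : 0 < fS S 0 - C * fx 0.
    by rewrite subr_gt0 ltNge; have := fgt S; rewrite cardS eqxx.
  near=> t => _; near: t; exact: (cvgr_gt _ lim _ S0).
move=> /nbhs_ballP[r /= r0 rP].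
have [t /andP[t0 tr] Atu] := small_shift_unitmx A0 r0.
have [S cardS] :=
  exists_subset_trace_invmx_le_unitmx C1 l0 x0 xC (Mt t Atu).
rewrite -fSE -/(fx t) leNgt -subr_gt0 rP //.
by rewrite /ball /= sub0r normrN gtr0_norm.
Unshelve. all: by end_near.
Qed.

(** * Attained optima and their ratio *)

Lemma set_minP (R : realType) (A : set R) (m : R) :
  is_minimum A m -> set_min A = m.
Proof.
move=> [Am mA]; have [] : is_minimum A (set_min A).
  by apply: (xgetI 0 (x := m)); split.
move=> As sA; apply/eqP; rewrite eq_le; apply/andP; split.
  exact: sA.
exact: mA.
Qed.

Section Optima.
Variables (R : realType) (n d : nat) (a : 'I_n -> 'cV[R]_d) (l : R).
Hypotheses (hdn : (d <= n)%N) (l_gt0 : 0 < l).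

Let set_objective (S : {set 'I_n}) :=
  \tr (invmx (\sum_(i in S) a i *m (a i)^T + l%:M)).
Let objective (x : 'rV[R]_n) :=
  \tr (invmx (\sum_i x 0 i *: (a i *m (a i)^T) + l%:M)).
Let feasible (x : 'rV[R]_n) :=
  (forall i, 0 <= x 0 i <= 1) /\ \sum_i x 0 i = d%:R.

Let indicator_feasible (S : {set 'I_n}) : #|S| = d ->
  feasible (\row_i (i \in S)%:R).
Proof.
move=> cardS; split=> [i|]; first by rewrite mxE ler0n lern1 leq_b1.
under eq_bigr do rewrite mxE.
rewrite -cardS -sum1_card [in RHS]big_mkcond natr_sum.
by apply: eq_bigr => i _; case: (i \in S).
Qed.

Let objective_indicator (S : {set 'I_n}) :
  objective (\row_i (i \in S)%:R) = set_objective S.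
Proof.
rewrite /objective /set_objective -sum_indicator.
by congr (\tr (invmx (_ + _))); apply: eq_bigr => i _; rewrite mxE.
Qed.

Lemma z_opt_attained : exists S : {set 'I_n},
  [/\ #|S| = d, z_opt a l d = set_objective S &
      forall S' : {set 'I_n}, #|S'| = d -> set_objective S <= set_objective S'].
Proof.
(* Since [d <= n], the first [d] indices give a candidate. *)
pose S0 : {set 'I_n} := widen_ord hdn @: [set: 'I_d].
have cardS0 : #|S0| == d.
  by rewrite card_imset ?cardsT ?card_ord // => i j /(congr1 val) /= /val_inj.
have [S /eqP cardS Smin] :=
  @arg_minP _ R _ _ (fun S : {set 'I_n} => #|S| == d) set_objective cardS0.
exists S; split=> // [|S' /eqP]; last exact: Smin.
apply: set_minP; split; first by exists S.
by move=> _ [S' /eqP cardS' ->]; apply: Smin.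
Qed.

(** Extreme value theorem on the slice of the cube by a hyperplane, which is compact, and nonempty
    because it contains indicators of [d]-sets. *)
Lemma nuC_opt_attained : exists x : 'rV[R]_n,
  [/\ feasible x, nuC_opt a l d = objective x &
      forall x', feasible x' -> objective x <= objective x'].
Proof.
pose box : set 'rV[R]_n :=
    [set v | forall i, `[0, 1] (v ord0 i)]%classic.
pose plane : set 'rV[R]_n :=
    ((fun v : 'rV[R]_n => \sum_i v 0 i) @^-1` [set d%:R])%classic.
pose K : set 'rV[R]_n := (box `&` plane)%classic.
have KE x : K x <-> feasible x.
  rewrite /K /box /plane /feasible /=; split=> -[x01 xd]; split=> // i;
  by have := x01 i; rewrite /= in_itv.
have coord i : continuous (fun v : 'rV[R]_n => v 0 i).
  exact: coord_continuous.
have plane_closed : closed plane.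
  apply: preimage_closed => [v _|]; last exact: closed_eq.
  by move: v; apply: continuous_big => //; exact: add_continuous.
have K_compact : compact K.
  apply: compact_closedI => //.
  apply: (@rV_compact R n (fun=> `[0, 1]%classic)) => i.
  exact: segment_compact.
(* The absolute values make the objective continuous on the whole space:
   with negative weights the regularized matrix may be singular. *)
pose g (x : 'rV[R]_n) := objective (\row_i `|x 0 i|).
have gE x : K x -> g x = objective x.
  move=> /KE[x01 _]; congr (objective _); apply/rowP => i.
  by rewrite mxE ger0_norm //; case/andP: (x01 i).
have g_cont : continuous g.
  move=> x; apply: (@cvg_gramD_trace_invmx R _ (nbhs x)) => // [v i|i|i r|i].
  - by rewrite mxE normr_ge0.
  - by rewrite mxE normr_ge0.
  - exact: cvg_cst.
  - rewrite mxE; under eq_cvg do rewrite mxE.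
    by apply: cvg_norm; exact: coord.
have [S [cardS _ _]] := z_opt_attained.
have K0 : (K !=set0)%classic.
  by exists (\row_i (i \in S)%:R); apply/KE/indicator_feasible.
have [x /set_mem Kx xmin] :=
  compact_EVT_min K0 K_compact (continuous_subspaceT g_cont).
have objmin x' : feasible x' -> objective x <= objective x'.
  by move=> /KE Kx'; rewrite -!gE //; apply: xmin; apply/mem_set.
have xf : feasible x by apply/KE.
exists x; split=> //.
apply: set_minP; split; first by exists x.
by move=> _ [x' x'f ->]; apply: objmin.
Qed.

Lemma nuC_opt_gt0 : (0 < d)%N -> 0 < nuC_opt a l d.
Proof.
move=> d0; have [x [[x01 _] -> _]] := nuC_opt_attained.
apply: psdD_trace_invmx_gt0 => //; apply: psd_gram => i.
by case/andP: (x01 i).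
Qed.

(** The indicator of an optimal set is feasible for the relaxation, with the same value. *)
Lemma nuC_opt_le_z_opt : nuC_opt a l d <= z_opt a l d.
Proof.
have [x [_ -> xmin]] := nuC_opt_attained.
have [S [cardS -> _]] := z_opt_attained.
by rewrite -objective_indicator; apply/xmin/indicator_feasible.
Qed.

Lemma z_opt_le_nuC_opt : (0 < d)%N ->
  z_opt a l d <= Num.min d%:R (n%:R - d%:R + 1) * nuC_opt a l d.
Proof.
move=> d0; have [x [[x01 xd] -> _]] := nuC_opt_attained.
have [S [_ -> Smin]] := z_opt_attained.
have [||T cardT|S' cardS' le_C] :=
  @exists_subset_trace_invmx_le R d _ a (fun i => x 0 i)
    (Num.min d%:R (n%:R - d%:R + 1)) l _ l_gt0 x01.
- by rewrite le_min ler1n d0 lerDr subr_ge0 ler_nat.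
- by rewrite xd.
(* The weight outside [T] is at most the total weight [d], and at most the number [n - d + 1] of
   indices outside [T], as [T] has [d - 1] elements and weights are at most 1. *)
- rewrite le_min; apply/andP; split.
    rewrite -xd big_mkcond.
    by apply: ler_sum => i _; case: ifP => // _; case/andP: (x01 i).
  have -> : n%:R - d%:R + 1 = #|~: T|%:R :> R.
    have := congr1 (fun m => m%:R : R) (cardsC T).
    by rewrite card_ord natrD -cardT -natr1 => <-; ring.
  rewrite -sum1_card natr_sum; apply: ler_sum => i _.
  by case/andP: (x01 i).
- by apply: le_trans le_C; exact: Smin.
Qed.
End Optima.

Theorem corollary3 (R : realType) (n d k : nat) (a : 'I_n -> 'cV[R]_d)
    (lambda : R) (hd : (0 < d)%N) (hdn : (d <= n)%N) (hlambda : 0 < lambda)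
    (hk : k = d) :
  1 <= z_opt a lambda k / nuC_opt a lambda k
    <= Num.min d%:R (n%:R - d%:R + 1).
Proof.
rewrite hk; have nu_gt0 := nuC_opt_gt0 a hdn hlambda hd.
rewrite ler_pdivlMr // ler_pdivrMr // mul1r.
by rewrite nuC_opt_le_z_opt // z_opt_le_nuC_opt.
Qed.
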